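(* There is a compact subset of $\mathbb{R}$ which has Lebesgue measure zero and is meager, but which is not a countable union of closed null-finite subsets of $\mathbb{R}$.
   Context: A subset $A$ of $\mathbb{R}$ is null-finite if there is a convergent sequence $(x_n)_{n\in\omega}\subseteq\mathbb{R}$ such that $\{n\in\omega:\ x_n-x\in A\}$ is finite for all $x\in\mathbb{R}$. *)

(* Defs.v *)
From mathcomp Require Import all_boot all_order all_algebra.
From mathcomp Require Import all_classical all_reals all_analysis.
Import Order.TTheory GRing.Theory Num.Theory.
Import numFieldNormedType.Exports.

Set Implicit Arguments.
Unset Strict Implicit.
Unset Printing Implicit Defensive.

Local Open Scope classical_set_scope.
Local Open Scope ring_scope.

Definition null_finite (R : realType) (A : set R) : Prop :=
  exists2 u : nat -> R, cvgn u &
    forall x : R, finite_set [set n | A (u n - x)].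

Definition nowhere_dense (T : topologicalType) (A : set T) : Prop :=
  (closure A)° = set0.

Definition meager (T : topologicalType) (A : set T) : Prop :=
  exists2 F : nat -> set T,
    (forall n, nowhere_dense (F n)) & A = \bigcup_n F n.

(* Every countable union is a union of a sequence: the empty set is closed and
   null-finite, so finite families can be padded. *)
Definition sigma_closed_null_finite (R : realType) (A : set R) : Prop :=
  exists2 F : nat -> set R,
    (forall n, closed (F n) /\ null_finite (F n)) & A = \bigcup_n F n.

(* Main.v *)
(* The compact set K consists of the x in [0, 1] such that, for all j, the
   digit of x at position j in the factorial number system (base q = j + 3
   there) is not 1, up to endpoints. Its measure is bounded by the telescoping product of the
   (q - 1) / q, hence vanishes.

   Given a sequence u converging to a, extract sparsely the terms
   v_k = u_(phi k) - a and build x by nested intervals, the term v_k being taken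
   into account only from level J + 2k on. At level j each of the translations
   considered (0 and the active v_k) excludes at most two of the j + 3
   subintervals, and fewer than (j + 1) / 2 translations are active, so that a
   subinterval survives. A term v_k not yet active is so small that x + v_k stays
   in the interval around x. Hence all the x + v_k lie in K, and starting from a
   small interval they lie in any prescribed portion of K: no portion of K is
   null-finite, and Baire's theorem on K concludes. *)

Require Import Defs.
From mathcomp Require Import all_boot all_order all_algebra.
From mathcomp Require Import all_classical all_reals all_analysis.
From mathcomp Require Import zify ring lra.
Import Order.TTheory GRing.Theory Num.Theory.
Import numFieldNormedType.Exports.

Set Implicit Arguments.
Unset Strict Implicit.
Unset Printing Implicit Defensive.

Local Open Scope classical_set_scope.
Local Open Scope ring_scope.

(** * The set [holed] and its approximation by cells *)

(* In the unit 1 / (j + 3)!, these are the intervals ]q m + 1, q m + 2[ with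
   q = j + 3: an open hole surrounded by cells keeps the remaining cells closed. *)
Definition hole (R : realType) (j : nat) : set R :=
  [set x | exists m : int,
    (j.+3%:Z * m + 1)%:~R < x * (j.+3)`!%:R < (j.+3%:Z * m + 2)%:~R].

Definition holed (R : realType) : set R :=
  [set x | 0 <= x <= 1 /\ forall j, ~ hole j x].

(** Level 0 consists of the two halves of [0, 1], of length 1 / 2!. Each further level keeps the
    digits 0, 2, ..., [J'.+2], so that only digit 1 is dropped. *)
Fixpoint cells (J : nat) : seq nat :=
  if J is J'.+1 then
    [seq (J'.+3 * i + d)%N | i <- cells J', d <- 0%N :: iota 2 J'.+1]
  else [:: 0%N; 1%N].

Definition cell (R : realType) (J i : nat) : set R :=
  [set x | i%:R <= x * (J.+2)`!%:R <= i.+1%:R].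

Lemma size_cells (J : nat) : size (cells J) = (2 * (J.+1)`!)%N.
Proof.
elim: J => [//|J IH].
transitivity (size (cells J) * size (0%N :: iota 2 J.+1))%N.
  exact: size_allpairs.
by rewrite IH /= size_iota [in RHS]factS; lia.
Qed.

Lemma fact_gt0R (R : realType) (n : nat) : (0 : R) < n`!%:R.
Proof. by rewrite ltr0n fact_gt0. Qed.

Lemma open_hole (R : realType) (j : nat) : open (@hole R j).
Proof.
set b : R := (j.+3)`!%:R; have b0 : 0 < b := fact_gt0R R _.
have -> : @hole R j = \bigcup_(m : int)
    `](j.+3%:Z * m + 1)%:~R / b, (j.+3%:Z * m + 2)%:~R / b[%classic.
  apply/seteqP; split=> x /=.
    by move=> [m hm]; exists m => //=; rewrite in_itv/= ltr_pdivrMr// ltr_pdivlMr.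
  by move=> [m _ /=]; rewrite in_itv/= ltr_pdivrMr// ltr_pdivlMr// => hm; exists m.
by apply: bigcup_open => m _; exact: interval_open.
Qed.

Lemma compact_holed (R : realType) : compact (@holed R).
Proof.
have hE : @holed R = `[0, 1]%classic `&` \bigcap_j ~` hole j.
  apply/seteqP; split=> x /=; rewrite in_itv/= => -[x01 h]; split=> // j.
    by move=> _; exact: h.
  exact: h.
have hcl : closed (\bigcap_j ~` @hole R j).
  by apply: closed_bigI => j _; apply: open_closedC; exact: open_hole.
rewrite hE; refine (compact_closedI _ hcl); apply: segment_compact.
Qed.

Lemma closed_holed (R : realType) : closed (@holed R).
Proof. by apply: compact_closed (@compact_holed R); exact: Rhausdorff. Qed.

(** Induction on the level: off the hole, the rescaled point [y] lies in the first subcell or at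
    least two units after the left end, where its integer part gives the digit. *)
Lemma holed_cell (R : realType) (J : nat) (x : R) :
  holed x -> exists2 i, i \in cells J & cell J i x.
Proof.
move=> [/andP[x0 x1] hx]; elim: J => [|J [i ic]].
  rewrite /cell/=; have [x2|x2] := lerP (x * 2) 1.
    by exists 0%N => //=; rewrite (_ : 2`! = 2%N)// x2 andbT; lra.
  by exists 1%N => //=; rewrite (_ : 2`! = 2%N)//; lra.
rewrite /cell/= => /andP[xi ix].
set y := x * (J.+3)`!%:R.
have yE : y = x * (J.+2)`!%:R * J.+3%:R.
  by rewrite /y [(J.+3)`!]factS natrM; ring.
have q0 : (0 : R) < J.+3%:R by rewrite ltr0n.
have iy : (J.+3 * i)%:R <= y.
  by rewrite natrM mulrC yE ler_pM2r.
have yi : y <= (J.+3 * i.+1)%:R.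
  by rewrite natrM mulrC yE ler_pM2r.
have y0 : 0 <= y by apply: le_trans iy.
have cellS d : (d \in 0%N :: iota 2 J.+1) ->
    (J.+3 * i + d)%:R <= y <= (J.+3 * i + d).+1%:R ->
    exists2 i0, i0 \in [seq (J.+3 * i + d)%N | i <- cells J, d <- 0%N :: iota 2 J.+1]
      & i0%:R <= y <= i0.+1%:R.
  move=> dS hy; exists (J.+3 * i + d)%N => //.
  by apply/allpairsP; exists (i, d).
have [y1|y1] := lerP y (J.+3 * i).+1%:R.
  by apply: (cellS 0%N) => //; rewrite addn0 iy.
have y2 : (J.+3 * i).+2%:R <= y.
  rewrite leNgt; apply/negP => y2; apply: (hx J); exists i%:Z; rewrite -/y.
  have -> : (J.+3%:Z * i%:Z + 1)%:~R = (J.+3 * i).+1%:R :> R.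
    by rewrite [RHS]pmulrn; congr _%:~R; lia.
  have -> : (J.+3%:Z * i%:Z + 2)%:~R = (J.+3 * i).+2%:R :> R.
    by rewrite [RHS]pmulrn; congr _%:~R; lia.
  by rewrite y1 y2.
have [yl|yl] := ltrP y (J.+3 * i.+1)%:R.
  have [f /andP[f1 f2]] : exists f : nat, f%:R <= y < f.+1%:R.
    by exists (Num.truncn y); exact: Num.Theory.truncn_itv.
  have h1 : (f < J.+3 * i.+1)%N by rewrite -(ltr_nat R); exact: le_lt_trans yl.
  have h2 : (J.+3 * i + 2 <= f)%N.
    by rewrite -ltnS -(ltr_nat R); apply: le_lt_trans f2; rewrite addn2.
  apply: (cellS (f - J.+3 * i)%N).
    by rewrite inE mem_iota; clear -h1 h2; lia.
  rewrite subnKC ?f1 ?(ltW f2)//; clear -h2; lia.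
(* Now [y] is the right end of the parent cell. Its integer part would fall in the next parent,
   hence the last digit. *)
apply: (cellS J.+2).
  by rewrite inE mem_iota; lia.
rewrite (_ : (J.+3 * i + J.+2).+1 = J.+3 * i.+1)%N; last lia.
by rewrite yi andbT; apply: le_trans yl; rewrite ler_nat; lia.
Qed.

Lemma cellW (R : realType) (J i d : nat) : (d <= J.+2)%N ->
  @cell R J.+1 (J.+3 * i + d) `<=` cell J i.
Proof.
move=> dJ x; rewrite /cell/= [(J.+3)`!]factS.
have q0 : (0 : R) < J.+3%:R by rewrite ltr0n.
rewrite natrM mulrCA => /andP[h1 h2]; apply/andP; split.
  rewrite -(ler_pM2l q0) -natrM; apply: le_trans h1.
  by rewrite ler_nat leq_addr.
rewrite -(ler_pM2l q0) -natrM; apply: (le_trans h2).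
by rewrite ler_nat; lia.
Qed.

Lemma cell_holed (R : realType) (J i : nat) (x : R) : i \in cells J ->
  cell J i x -> 0 <= x <= 1 /\ forall j, (j < J)%N -> ~ hole j x.
Proof.
elim: J i => [|J IH] i.
  by rewrite /cell/= !inE (_ : 2`! = 2%N)// => /orP[]/eqP-> h; split=> //; lra.
move=> /allpairsP[[i' d] /= [i'c dS ->]] xc.
have dJ : (d <= J.+2)%N by move: dS; rewrite !inE mem_iota; lia.
have [x01 hx] := IH _ i'c (cellW dJ xc).
split=> // j; rewrite ltnS leq_eqVlt => /predU1P[-> [m /andP[m1 m2]]|]; last exact: hx.
move: xc; rewrite /cell/= => /andP[x1 x2].
(* Since the hole is open, it meets the cell only if the integer left ends agree. With [d <= J.+2]
   this forces [i' = m] and [d = 1], the excluded digit. *)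
have := le_lt_trans x1 m2; have := lt_le_trans m1 x2.
rewrite !pmulrn !ltr_int => u1 u2.
have im : i'%:Z = m by clear -u1 u2 dJ; nia.
by move: dS u1 u2; rewrite !inE mem_iota -im; clear; lia.
Qed.

(** * Measure zero *)

Lemma le_measure_cells (R : realType) (J : nat) (s : seq nat) :
  let A := [set x : R | exists2 i, i \in s & cell J i x] in
  measurable A /\ (lebesgue_measure A <= ((size s)%:R / (J.+2)`!%:R)%:E)%E.
Proof.
have b0 : (0 : R) < (J.+2)`!%:R := fact_gt0R R _.
elim: s => [|i s [mA IH]] /=.
  rewrite (_ : [set x | _] = set0) ?measure0 ?mul0r; first by split=> //; exact: measurable0.
  by apply/seteqP; split=> x //= -[].
set I := `[i%:R / (J.+2)`!%:R, i.+1%:R / (J.+2)`!%:R : R]%classic.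
have -> : [set x : R | exists2 i0, i0 \in i :: s & cell J i0 x] =
    I `|` [set x : R | exists2 i0, i0 \in s & cell J i0 x].
  apply/seteqP; split=> x /=.
    move=> [k]; rewrite inE => /predU1P[->|ks kx]; last by right; exists k.
    by left; rewrite /I/= in_itv/= ler_pdivrMr// ler_pdivlMr.
  move=> [|[k ks kx]]; last by exists k; rewrite // inE ks orbT.
  rewrite /I/= in_itv/= ler_pdivrMr// ler_pdivlMr// => ix.
  by exists i; rewrite ?mem_head.
have mI : measurable I by exact: measurable_itv.
split; first exact: measurableU.
set B := [set x : R | _] in mA IH *.
apply: (@le_trans _ _ (lebesgue_measure I + lebesgue_measure B)%E).
  exact: measureU2.
rewrite -(addn1 (size s)) natrD mulrDl EFinD addeC; apply: leeD => //.
rewrite /I lebesgue_measure_itv/= lte_fin ltr_pM2r ?invr_gt0//.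
by rewrite ltr_nat ltnSn -EFinB lee_fin -mulrBl -natrB ?subSnn.
Qed.

(** The cells of level [J] have total length at most 2 (J+1)! / (J+2)! = 2 / (J+2), which tends to
    0. *)
Lemma lebesgue_measure_holed (R : realType) :
  lebesgue_measure (@holed R) = 0%E.
Proof.
have mK : measurable (@holed R).
  by exact: measurable_realfun.closed_measurable (@closed_holed R).
apply/eqP; rewrite eq_le measure_ge0 andbT.
apply/lee_addgt0Pr => e e0; rewrite add0e.
have [J _ hJ] := @near_infty_natSinv_lt R (PosNum (divr_gt0 e0 (ltr0Sn R 1))).
have [mA leA] := @le_measure_cells R J (cells J).
apply: (@le_trans _ _ (lebesgue_measure [set x : R | exists2 i, i \in cells J & cell J i x])).
  by apply: le_measure; rewrite ?inE// => x /holed_cell; exact.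
apply: (le_trans leA); rewrite lee_fin size_cells [(J.+2)`!]factS.
have b0 : (0 : R) < (J.+1)`!%:R := fact_gt0R R _.
have J2 : (J.+2%:R : R)^-1 <= J.+1%:R^-1.
  by rewrite lef_pV2 ?posrE ?ltr0n// ler_nat.
rewrite natrM (natrM R J.+2 (J.+1)`!) invfM mulrACA divff ?gt_eqF// mulr1 mulrC.
rewrite -ler_pdivlMr//.
by apply: (le_trans J2); apply: ltW; exact: (hJ J (leqnn J)).
Qed.

(** * Nested intervals, avoidance of translated holes, Baire's theorem *)

Lemma nested_itv_sub (R : realType) (c l : nat -> R) :
  (forall i, c i <= c i.+1) -> (forall i, c i.+1 + l i.+1 <= c i + l i) ->
  forall i j, (i <= j)%N -> c i <= c j /\ c j + l j <= c i + l i.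
Proof.
move=> cS clS i j /subnKC <-; elim: (j - i)%N => [|d [h1 h2]].
  by rewrite addn0.
by rewrite addnS; split; [apply: le_trans h1 _|apply: le_trans h2].
Qed.

Lemma nested_itv (R : realType) (c l : nat -> R) :
  (forall i, 0 <= l i) -> (forall i, c i <= c i.+1) ->
  (forall i, c i.+1 + l i.+1 <= c i + l i) ->
  exists x, forall i, c i <= x <= c i + l i.
Proof.
move=> l0 cS clS; have sub := nested_itv_sub cS clS.
have cub i j : c i <= c j + l j.
  have [/sub[ij _]|/ltnW/sub[_ ji]] := leqP i j.
    by apply: (le_trans ij); rewrite lerDl.
  by apply: le_trans ji; rewrite lerDl.
exists (sup (range c)) => i; apply/andP; split.
  apply: ub_le_sup; last by exists i.
  by exists (c 0%N + l 0%N) => _ [j _ <-].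
by apply: ge_sup; [exists (c 0%N), 0%N | move=> _ [j _ <-]].
Qed.

Lemma avoid_residues (q : nat) (s : seq nat) : (size s < q)%N ->
  exists2 k, (k < q)%N & k \notin s.
Proof.
move=> sq; apply: contrapT => h.
have : (size (iota 0 q) <= size s)%N.
  apply: uniq_leq_size; first exact: iota_uniq.
  move=> k; rewrite mem_iota/= => kq; apply/negP => /negP ks.
  by apply: h; exists k.
by rewrite size_iota leqNgt sq.
Qed.

(* A translate of a hole meets only cells whose index has one of two residues
   modulo j + 3; the two extreme cells are excluded as well to keep a margin. *)
Lemma avoid_hole (R : realType) (j : nat) (c : R) (t : seq R) :
  (2 * size t + 2 < j.+3)%N ->
  exists c', [/\ c + (j.+3)`!%:R^-1 <= c',
    c' + 2 * (j.+3)`!%:R^-1 <= c + (j.+2)`!%:R^-1 &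
    forall s y, s \in t -> c' <= y <= c' + (j.+3)`!%:R^-1 -> ~ hole j (y + s)].
Proof.
move=> st; set u : R := (j.+3)`!%:R.
have u0 : 0 < u := fact_gt0R R _.
(* For [y] in subinterval [k], the number [(y + s) * u] lies between [z s + k] and [z s + k + 2]. It
   can be in a hole only if [z s + k] is 0 or 1 modulo [j.+3]. *)
pose z s := Num.floor ((c + s) * u).
pose bad := [:: 0%N; j.+2] ++ [seq `|(- z s %% j.+3%:Z)%Z|%N | s <- t]
                           ++ [seq `|((1 - z s) %% j.+3%:Z)%Z|%N | s <- t].
have [k kq] : exists2 k, (k < j.+3)%N & k \notin bad.
  by apply: avoid_residues; rewrite /bad !size_cat !size_map/=; lia.
rewrite /bad !mem_cat !inE !negb_or => /andP[/andP[k0 kj] /andP[k1 k2]].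
have uE : (j.+2)`!%:R^-1 = j.+3%:R / u :> R.
  by rewrite /u [(j.+3)`!]factS natrM invfM mulrA divff ?mul1r// pnatr_eq0.
have iu0 : 0 < u^-1 by rewrite invr_gt0.
exists (c + k%:R / u); split.
- by rewrite lerD2l ler_peMl ?(ltW iu0)// ler1n; clear -k0; lia.
- rewrite -addrA lerD2l uE -mulrDl ler_pM2r// -natrD ler_nat; clear -kj kq; lia.
move=> s y sin; rewrite -lerBlDr => /andP[y1 y2] [m].
rewrite -/u => /andP[m1 m2].
have /andP[z1 z2] := Num.Theory.floor_itv ((c + s) * u).
rewrite -/(z s) in z1 z2.
have v1 : k%:R <= (y - c) * u by rewrite -ler_pdivrMr//; lra.
have v2 : (y - c) * u <= k%:R + 1 by rewrite -ler_pdivlMr// mulrDl mul1r; lra.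
have w1 : (z s + k%:Z)%:~R <= (y + s) * u.
  by rewrite intrD -pmulrn; nra.
have w2 : (y + s) * u < (z s + k%:Z + 2)%:~R.
  by rewrite 2!intrD -pmulrn; rewrite intrD in z2; nra.
have := le_lt_trans w1 m2; have := lt_trans m1 w2; rewrite !ltr_int => e1 e2.
have [kz|kz] : k%:Z = - z s + m * j.+3%:Z \/ k%:Z = 1 - z s + m * j.+3%:Z.
- by clear -e1 e2; lia.
- move/negP: k1; apply; apply/mapP; exists s => //.
  suff -> : (- z s %% j.+3)%Z = k%:Z by [].
  by rewrite -(modzMDl m) addrC -kz modz_small//; clear -kq; lia.
- move/negP: k2; apply; apply/mapP; exists s => //.
  suff -> : ((1 - z s) %% j.+3)%Z = k%:Z by [].
  by rewrite -(modzMDl m) addrC -kz modz_small//; clear -kq; lia.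
Qed.

(** Otherwise nested balls centred in [K], with radii tending to 0, can avoid the [F n] one after
    the other. Their common point is in [K] but in no [F n]. *)
Lemma baire_closed (R : realType) (K : set R) (F : nat -> set R) :
  closed K -> K !=set0 -> (forall n, closed (F n)) -> K `<=` \bigcup_n F n ->
  exists n p, exists e : R,
    [/\ K p, 0 < e & forall y, K y -> `|y - p| < e -> F n y].
Proof.
move=> clK [p0 Kp0] clF KF; apply: contrapT => noball.
(* [a] is an index with a centre and a radius, [b] the next centre and radius. The premises inside
   make the relation total, as [choice] requires. *)
pose good (a : nat * (R * R)) (b : R * R) := K a.2.1 -> 0 < a.2.2 ->
  [/\ K b.1, 0 < b.2, `|b.1 - a.2.1| + b.2 <= a.2.2, b.2 <= a.1.+1%:R^-1 &
      forall y, `|y - b.1| <= b.2 -> ~ F a.1 y].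
have /choice[f fP] : forall a, exists b, good a b.
  move=> [n [p e]]; rewrite /good/=.
  have [Kp|nKp] := pselect (K p); last by exists (p, e).
  have [e0|ne0] := pselect (0 < e); last by exists (p, e).
  have [q [Kq qp nFq]] : exists q, [/\ K q, `|q - p| < e & ~ F n q].
    apply: contrapT => h; apply: noball; exists n, p, e; split=> // y Ky yp.
    by apply: contrapT => nFy; apply: h; exists y.
  have : nbhs q (~` F n).
    by apply: open_nbhs_nbhs; split=> //; exact: closed_openC.
  move=> /nbhs_ballP[r /= r0 rF].
  pose e' := Num.min (r / 2) (Num.min (e - `|q - p|) n.+1%:R^-1).
  have e'0 : 0 < e' by rewrite !lt_min divr_gt0// subr_gt0 qp invr_gt0 ltr0n.
  have [e'r e'p e'n] : [/\ e' <= r / 2, e' <= e - `|q - p| & e' <= n.+1%:R^-1].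
    by split; rewrite !ge_min lexx ?orbT.
  exists (q, e') => _ _ /=; split=> //; first by rewrite addrC -lerBrDr.
  move=> y yq; apply: rF; rewrite /ball/= distrC.
  by apply: (le_lt_trans (le_trans yq e'r)); lra.
pose s := fix s n := if n is n'.+1 then f (n', s n') else (p0, 1).
have sK n : K (s n).1 /\ 0 < (s n).2.
  by elim: n => [//|n [h1 h2]] /=; have [] := fP (n, s n) h1 h2.
have sS n := fP (n, s n) (sK n).1 (sK n).2.
have [x xs] : exists x, forall n,
    (s n).1 - (s n).2 <= x <= (s n).1 - (s n).2 + 2 * (s n).2.
  apply: (@nested_itv _ _ (fun n => 2 * (s n).2)) => n.
  - by rewrite mulr_ge0// ltW//; have [] := sK n.
  - have [_ _ + _ _] := sS n; rewrite /= -lerBrDr ler_norml => /andP[]; lra.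
  - have [_ _ + _ _] := sS n; rewrite /= -lerBrDr ler_norml => /andP[]; lra.
have xsn n : `|x - (s n).1| <= (s n).2.
  by rewrite ler_norml; have := xs n; lra.
have Kx : K x.
  apply: (@closed_cvg _ _ \oo _ (fun n => (s n.+1).1) K clK).
    by apply: nearW => n; have [] := sK n.+1.
  apply/cvgrPdist_le => e e0.
  have := near_infty_natSinv_lt (PosNum e0); apply: filterS => n /= ne.
  apply: (le_trans (xsn n.+1)); apply: le_trans (ltW ne).
  by have [] := sS n.
have [n _ Fx] := KF _ Kx.
by have [_ _ _ _ /(_ x (xsn n.+1))] := sS n.
Qed.

(** * No portion of [holed] is null-finite *)

Lemma not_null_finite_holed (R : realType) (F : set R) (p e : R) :
  holed p -> 0 < e -> (forall y, holed y -> `|y - p| < e -> F y) ->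
  ~ null_finite F.
Proof.
move=> hp e0 hF [u cu fin].
set a := limn u in cu *.
have [J0 _ hJ0] := near_infty_natSinv_lt (PosNum e0).
(* [J0] makes the initial interval shorter than [e]. The 4 serves the count in [avoid_hole]: [t i]
   has i/2 + 2 entries, and i + 6 < J + i + 3 is needed. *)
pose J := (J0 + 4)%N.
pose l i : R := (J + i).+2`!%:R^-1.
have l_gt0 i : 0 < l i by rewrite invr_gt0 fact_gt0R.
have l0e : l 0%N < e.
  apply: le_lt_trans (hJ0 J0 (leqnn J0)) => /=.
  rewrite /l lef_pV2 ?posrE ?ltr0n ?fact_gt0// ler_nat.
  by apply: leq_trans (fact_geq _); rewrite /J; lia.
have [m mJ pm] := holed_cell J hp.
(* The bound [l k.*2.+1] is the margin left on both sides by step [k.*2], so adding [v k] to the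
   limit point stays inside interval [k.*2]. *)
have /choice[phi phiP] : forall k, exists n, (k <= n)%N /\ `|u n - a| <= l (k.*2.+1).
  move=> k; have /cvgrPdist_le/(_ _ (l_gt0 k.*2.+1))[N _ hN] := cu.
  exists (maxn k N); rewrite leq_maxl distrC; split=> //.
  by apply: hN => /=; exact: leq_maxr.
pose v k := u (phi k) - a.
pose t i := 0 :: [seq v k | k <- iota 0 (i./2.+1)].
have /choice[f fP] : forall ic : nat * R, exists c', [/\ ic.2 + l ic.1.+1 <= c',
    c' + 2 * l ic.1.+1 <= ic.2 + l ic.1 &
    forall s y, s \in t ic.1 -> c' <= y <= c' + l ic.1.+1 ->
      ~ hole (J + ic.1) (y + s)].
  move=> [i c] /=; rewrite /l addnS; apply: avoid_hole.
  by rewrite /t/= size_map size_iota /J; have := odd_double_half i; lia.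
pose c := fix c i := if i is i'.+1 then f (i', c i') else m%:R / (J.+2)`!%:R.
have cP i : [/\ c i + l i.+1 <= c i.+1, c i.+1 + 2 * l i.+1 <= c i + l i &
    forall s y, s \in t i -> c i.+1 <= y <= c i.+1 + l i.+1 ->
      ~ hole (J + i) (y + s)] := fP (i, c i).
have cS i : c i <= c i.+1 by have [+ _ _] := cP i; have := l_gt0 i.+1; lra.
have clS i : c i.+1 + l i.+1 <= c i + l i.
  by have [_ + _] := cP i; have := l_gt0 i.+1; lra.
have sub := nested_itv_sub cS clS.
have [x xP] := nested_itv (fun i => ltW (l_gt0 i)) cS clS.
have cell0 y : cell J m y <-> c 0%N <= y <= c 0%N + l 0%N.
  have b0 : (0 : R) < (J.+2)`!%:R := fact_gt0R R _.
  rewrite /l addn0 /= -[X in _ + X]mul1r -mulrDl ler_pdivrMr// ler_pdivlMr//.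
  by rewrite natr1 /cell.
have Fv k : F (x + v k).
  have xv : c k.*2 <= x + v k <= c k.*2 + l k.*2.
    have [_] := phiP k; rewrite -/(v k) ler_norml.
    have [h1 h2 _] := cP k.*2; have /andP[h3 h4] := xP k.*2.+1.
    by move=> /andP[h5 h6]; apply/andP; split; lra.
  have xvS i : (i <= k.*2)%N -> c i <= x + v k <= c i + l i.
    by move=> /sub; lra.
  have xvm : cell J m (x + v k) by apply/cell0; exact: xvS.
  apply: hF; last first.
    apply: le_lt_trans l0e; rewrite ler_norml.
    have /andP[h1 h2] := (cell0 p).1 pm; have /andP[h3 h4] := xvS 0%N isT.
    by apply/andP; split; lra.
  have [xv01 nh] := cell_holed mJ xvm; split=> // j.
  have [jJ|Jj] := ltnP j J; first exact: nh.
  rewrite -(subnKC Jj); set i := (j - J)%N.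
  have [_ _ nhi] := cP i.
  (* Before step [k.*2] the point [x + v k] is itself in the nested interval and translation 0
     suffices. From then on [x] is in the interval and [v k] belongs to [t i]. *)
  have [ik|ki] := ltnP i k.*2.
    by rewrite -[_ + v k]addr0; apply: nhi; rewrite ?mem_head//; exact: (xvS i.+1).
  apply: nhi; last exact: (xP i.+1).
  rewrite inE; apply/orP; right; apply/mapP; exists k => //.
  by rewrite mem_iota/=; have := odd_double_half i; clear -ki; lia.
(* Every [phi k] is in this finite set, yet [phi N >= N] exceeds its maximum. *)
have /finite_seqP[s sE] := fin (a - x).
pose N := (\max_(n <- s) n).+1.
have : [set n | F (u n - (a - x))] (phi N).
  by rewrite /= (_ : _ - _ = x + v N) // /v; ring.
rewrite sE /= => phis.
have hN : (phi N <= \max_(n <- s) n)%N by exact: (@leq_bigmax_seq _ s xpredT id).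
by have [] := phiP N; rewrite leqNgt ltnS hN.
Qed.

(** * Meagerness and conclusion *)

Lemma holed0 (R : realType) : @holed R 0.
Proof.
split=> [|j [m]]; first by rewrite lexx ler01.
by rewrite mul0r ltr0z ltrz0 => /andP[]; clear; nia.
Qed.

(** A closed null set contains no ball, so [holed] is itself nowhere dense. *)
Lemma meager_holed (R : realType) : meager (@holed R).
Proof.
exists (fun=> @holed R); last first.
  by apply/seteqP; split=> x; [exists 0%N | move=> [_ _]].
move=> _; rewrite /nowhere_dense -(closure_id _).1; last exact: closed_holed.
apply/seteqP; split=> // p /nbhs_ballP[r /= r0 rK].
have : (lebesgue_measure (ball p r) <= lebesgue_measure (@holed R))%E.
  apply: le_measure; rewrite ?inE//; first exact: measurable_realfun.measurable_ball.
  exact: measurable_realfun.closed_measurable (@closed_holed R).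
rewrite lebesgue_measure_holed lebesgue_measure_ball ?(ltW r0)// lee_fin.
by rewrite leNgt pmulrn_lgt0// r0.
Qed.

Theorem corollary7p4 (R : realType) :
  exists K : set R,
    [/\ compact K,
        lebesgue_measure K = 0%E,
        meager K &
        ~ sigma_closed_null_finite K].
Proof.
exists (@holed R); split.
- exact: compact_holed.
- exact: lebesgue_measure_holed.
- exact: meager_holed.
move=> [F Fcn KF].
have [|||n [p [e [Kp e0 hF]]]] := baire_closed (@closed_holed R) (F := F).
- by exists 0; exact: holed0.
- by move=> n; exact: (Fcn n).1.
- by rewrite -KF.
exact: (not_null_finite_holed Kp e0 hF) (Fcn n).2.
Qed.
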